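(* Let $n$ and $r$ be positive integers with $r<n$. Let $K_{2n}$ be the complete graph with vertex set $[2n]=\{1,\dots,2n\}$ and edge set $E=\binom{[2n]}{2}$, and let $\mathcal{M}^r_n$ be the family of all matchings in $K_{2n}$ consisting of exactly $r$ edges. Call $\mathcal{A}\subseteq\mathcal{M}^r_n$ intersecting if any two matchings in $\mathcal{A}$ share at least one edge. For $e\in E$ let $\mathcal{M}^r_n(e)=\{A\in\mathcal{M}^r_n : e\in A\}$, and let $$\phi(n,r)=\frac{\binom{2n-2}{2}\binom{2n-4}{2}\cdots\binom{2n-2(r-1)}{2}}{(r-1)!}.$$ If $\mathcal{A}\subseteq\mathcal{M}^r_n$ is intersecting, then $|\mathcal{A}|\le\phi(n,r)$, and equality holds if and only if $\mathcal{A}=\mathcal{M}^r_n(e)$ for some edge $e\in E$.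
   Context: For each edge $e$, $|\mathcal{M}^r_n(e)|=\phi(n,r)$ (for $r=1$, the empty product gives $\phi(n,1)=1$). *)

(* Defs.v *)
From mathcomp Require Import all_boot all_order all_algebra.
Set Implicit Arguments.
Unset Strict Implicit.
Unset Printing Implicit Defensive.

(* The vertex set {1, ..., 2n} of K_{2n} is represented by 'I_(2 * n), i.e.
   {0, ..., 2n - 1}; an edge is a two-element set of vertices. *)
Definition edges (n : nat) : {set {set 'I_(2 * n)}} :=
  [set e : {set 'I_(2 * n)} | #|e| == 2].

(* A matching is identified with its set of edges, and trivIset says that these
   are pairwise disjoint. *)
Definition matchings (n r : nat) : {set {set {set 'I_(2 * n)}}} :=
  [set M : {set {set 'I_(2 * n)}} |
    [&& M \subset edges n, trivIset M & #|M| == r]].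

Definition matchings_through (n r : nat) (e : {set 'I_(2 * n)}) :
    {set {set {set 'I_(2 * n)}}} :=
  [set M in matchings n r | e \in M].

(* The two matchings are not required to be distinct; for families of nonempty
   matchings this makes no difference. *)
Definition intersecting (n : nat) (A : {set {set {set 'I_(2 * n)}}}) : Prop :=
  {in A &, forall M N, M :&: N != set0}.

(* Rational-valued, so that the quotient is a genuine one; the product is empty
   for r = 1. *)
Definition phi (n r : nat) : rat :=
  ((\prod_(1 <= i < r) 'C(2 * n - 2 * i, 2))%N%:R / ((r - 1)`!)%N%:R)%R.

(* Main.v *)
Require Import Defs.
From mathcomp Require Import all_boot all_order all_algebra.
From mathcomp Require Import fingroup perm zify.
Set Implicit Arguments.
Unset Strict Implicit.
Unset Printing Implicit Defensive.

(** Katona's cycle method. On the vertices Z_(2n-1) and infinity, the edges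
    {t + m, t - m} (with {t, infinity} for m = 0), 0 <= m < n, listed in the
    order of t n + m, form a cyclic sequence of all N = n (2n - 1) edges in which
    any n - 1 consecutive ones are disjoint. In each relabelling u of the vertices,
    at most r of the N arcs of r consecutive edges belong to an intersecting
    family, since 3 r <= N; averaging over u gives N |A| <= r |M^r_n|, which is the
    bound.

    If equality holds, then for every u the arcs in A are exactly those through
    one position of the cycle. Some u has position n - 1 as this centre, and the
    set of such u is invariant under precomposition with any transposition that
    preserves the edges at positions n - 1, ..., n - 1 + r, or those at positions
    n - 1 - r, ..., n - 1. The first kind includes the two ends of each edge
    {1 + k, 1 - k} with k < n - 2, the second kind those of each {k, - k}; these
    connect all the vertices outside the edge at position n - 1. So the set is
    invariant under every permutation preserving that edge, and A contains all
    the matchings through its image. *)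

(** * Sums over a period and congruences *)

Lemma sum_periodic_shift (N : nat) (F : nat -> nat) (z : nat) :
  (forall i, F (i + N) = F i) ->
  \sum_(i < N) F (z + i) = \sum_(i < N) F i.
Proof.
move=> perF; elim: z => [|z IHz]; first by apply: eq_bigr => i _.
rewrite -IHz; case: N perF {IHz} => [|N] perF; first by rewrite !big_ord0.
rewrite big_ord_recr big_ord_recl /= addn0 addnC; congr (_ + _).
  by rewrite addSnnS perF.
by apply: eq_bigr => i _; rewrite addSnnS.
Qed.

Lemma eqmodn_leqE (N a b : nat) :
  a = b %[mod N] -> a <= b -> exists c, b = a + c * N.
Proof.
move=> eq_ab le_ab; have /dvdnP[c Dc] : N %| b - a.
  by rewrite -eqn_mod_dvd //; apply/eqP.
by exists c; rewrite -Dc subnKC.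
Qed.

Lemma eqmodn_between (N a b : nat) :
  a = b %[mod N] -> a < b -> a + N <= b.
Proof.
move=> eq_ab lt_ab; have [c Db] := eqmodn_leqE eq_ab (ltnW lt_ab).
by case: c Db => [|c]; rewrite ?mulSn; lia.
Qed.

(** * Pairwise meeting arcs of length [r] on a cycle of [N] positions, [p i] standing for the arc
    that starts at [i] *)

Section Arcs.

Variables (N r : nat) (p : pred nat).
Hypothesis r3_le : 3 * r <= N.
Hypothesis per_p : forall i, p (i + N) = p i.
Hypothesis meet_p : forall i j, p i -> p j ->
  exists k l, [/\ k < r, l < r & i + k = j + l %[mod N]].

(** Take for z the earliest member start among i0 - (r - 1), ..., i0. A member starting r or more
    after z can meet the arc at z only by wrapping round the cycle, so it starts shortly before z;
    then either it contradicts the choice of z, or it ends before [i0]. *)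
Lemma arcs_window i0 : p i0 ->
  exists2 z, p z & forall i, i < N -> p (z + i) -> i < r.
Proof.
move=> p_i0; have r_gt0: 0 < r by have [k [l []]] := meet_p p_i0 p_i0; lia.
(* Adding the period [N] keeps the subtraction from truncating. *)
pose w := i0 + N - r.-1.
have Dw: w + r.-1 = i0 + N by rewrite /w; lia.
have p_end: p (w + r.-1) by rewrite Dw per_p.
have ex_k: exists k, p (w + k) by exists r.-1.
case: (ex_minnP ex_k) => k pk min_k.
have le_k: k <= r.-1 by apply: min_k.
exists (w + k) => // i lt_iN pi; rewrite ltnNge; apply/negP => le_ri.
have [k1 [l1 [lt_k1 lt_l1 eq1]]] := meet_p pk pi.
have lt1 : w + k + k1 < w + k + i + l1 by lia.
have le1 := eqmodn_between eq1 lt1.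
have [le_Nik|lt_ikN] := leqP N (i + k).
  have: k <= i + k - N.
    by apply: min_k; rewrite -per_p; congr (p _): pi; lia.
  by lia.
(* The arc now ends before [i0 + N], and [3 * r <= N] prevents it from meeting the arc at [i0] on
   the other side. *)
have [k2 [l2 [lt_k2 lt_l2 eq2]]] := meet_p p_end pi.
have lt2 : w + r.-1 + k2 < w + k + i + l2 by lia.
by have := eqmodn_between eq2 lt2; lia.
Qed.

Lemma sum_window : r <= N -> \sum_(i < N) (i < r) = r.
Proof.
move/subnKC <-; rewrite big_split_ord /= [X in _ + X]big1 => [|i _].
  by rewrite addn0 (eq_bigr (fun=> 1)) ?sum1_card ?card_ord // => i _; rewrite ltn_ord.
by rewrite ltnNge leq_addr.
Qed.

Lemma arcs_card_leqif z : (forall i, i < N -> p (z + i) -> i < r) ->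
  \sum_(i < N) p i <= r ?= iff [forall i : 'I_N, p (z + i) == (i < r)].
Proof.
move=> zP; have le_rN : r <= N by lia.
rewrite -(@sum_periodic_shift N (fun i => p i : nat) z) => [|i]; last by rewrite per_p.
rewrite -[X in _ <= X ?= iff _](sum_window le_rN); apply: leqif_sum => i _.
split; first by case: (boolP (p _)) => // /zP->.
by case: (p _); case: (_ < _).
Qed.

Lemma arcs_card : \sum_(i < N) p i <= r.
Proof.
have [i0 p_i0 | no_p] := pickP (fun i : 'I_N => p i).
  by have [z _ /arcs_card_leqif->] := arcs_window p_i0.
by rewrite big1 // => i _; have /= -> := no_p i.
Qed.

Lemma arcs_card_eq : 0 < r -> \sum_(i < N) p i = r ->
  exists z, forall i, p (z + i) = (i %% N < r).
Proof.
move=> r_gt0 sum_p.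
have [i0 p_i0 | no_p] := pickP (fun i : 'I_N => p i); last first.
  by move: r_gt0; rewrite -sum_p big1 // => i _; have /= -> := no_p i.
have [z _ /arcs_card_leqif[_]] := arcs_window p_i0.
rewrite sum_p eqxx => /esym/forallP zP; exists z => i.
have N_gt0 : 0 < N by lia.
rewrite -(eqP (zP (Ordinal (ltn_pmod i N_gt0)))) /= {1}(divn_eq i N).
elim: (i %/ N) => [|c IHc]; first by rewrite mul0n add0n.
by rewrite -IHc -[in RHS]per_p; congr (p _); rewrite mulSn; lia.
Qed.

(** The number [m] is the offset of [x] from the start of the run of [r] members. *)
Lemma arcs_card_window : 0 < r -> \sum_(i < N) p i = r ->
  forall x, exists2 m, m < N & forall d, p (x + d) = ((m + d) %% N < r).
Proof.
move=> r_gt0 /(arcs_card_eq r_gt0)[z zP] x; have N_gt0 : 0 < N by lia.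
have per_pM c i : p (i + c * N) = p i.
  by elim: c => [|c IHc]; rewrite ?addn0 // mulSn [N + _]addnC addnA per_p.
have le_z : z <= x + z * N by apply: leq_trans (leq_pmulr z N_gt0) (leq_addl _ _).
exists ((x + z * N - z) %% N) => [|d]; first exact: ltn_pmod.
by rewrite modnDml -zP -(per_pM z); congr (p _); lia.
Qed.

Lemma arcs_card_ends y : 0 < r -> \sum_(i < N) p i = r ->
  p (y + r) && ~~ p (y + r.+1) = ~~ p y && p y.+1.
Proof.
move=> r_gt0 sum_p; have [m lt_mN pE] := arcs_card_window r_gt0 sum_p y.
rewrite -[in RHS](addn0 y) -addnS !pE addn0 (modn_small lt_mN).
have modN a : a < 2 * N -> a %% N = if a < N then a else a - N.
  move=> lt_a; case: ltnP => [|le_Na]; first exact: modn_small.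
  by rewrite -{1}(subnK le_Na) modnDr modn_small //; lia.
rewrite !modN; [|lia|lia|lia].
case: (ltnP (m + r) N) => ?; case: (ltnP (m + r.+1) N) => ?;
  case: (ltnP (m + 1) N) => ?; lia.
Qed.

Lemma arcs_card_last s : 0 < r -> \sum_(i < N) p i = r -> p s ->
  exists x, [/\ s <= x < s + r, p x & ~~ p x.+1].
Proof.
move=> r_gt0 sum_p ps; have [m lt_mN pE] := arcs_card_window r_gt0 sum_p s.
have lt_mr : m < r by move: ps; rewrite -(addn0 s) pE addn0 modn_small.
exists (s + (r.-1 - m)); rewrite -addnS !pE; split; first by lia.
  by rewrite modn_small; lia.
by rewrite modn_small; lia.
Qed.

End Arcs.

(** Induction on [s]: a permutation that is right on the tail is corrected at [i] by swapping its
    value with the wanted one. The values already right stay put, because [g] and [h] identify the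
    same indices. *)
Lemma perm_extending (I : eqType) (V : finType) (g h : I -> V) (s : seq I) :
  {in s &, forall i j, (g i == g j) = (h i == h j)} ->
  exists u : {perm V}, {in s, forall i, u (g i) = h i}.
Proof.
elim: s => [|i s IHs] eq_gh; first by exists 1%g.
have [|u uP] := IHs.
  by move=> j k sj sk; apply: eq_gh; rewrite inE ?sj ?sk orbT.
exists (u * tperm (u (g i)) (h i))%g => j; rewrite inE permM.
have [-> _|ne_ji /= sj] := eqVneq j i; first by rewrite tpermL.
have := eq_gh i j; rewrite !inE eqxx sj orbT => /(_ isT isT) Dgh.
have [Dg|ne_g] := eqVneq (g i) (g j).
  by rewrite Dg tpermL; apply/eqP; rewrite -Dgh Dg.
rewrite -(uP j sj) tpermD //; first by rewrite (inj_eq perm_inj).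
by rewrite (uP j sj) -Dgh.
Qed.

(** * Arithmetic of the labels *)

Lemma modn_lt_double (P a : nat) : a < 2 * P ->
  (a %% P = a /\ a < P) \/ (a %% P = a - P /\ P <= a).
Proof.
move=> lt_a; have [lt_aP|le_Pa] := ltnP a P; [left|right]; split=> //.
  exact: modn_small.
by rewrite -{1}(subnK le_Pa) modnDr modn_small //; lia.
Qed.

Ltac split_lia := intros;
  repeat match goal with
    | H : _ /\ _ |- _ => destruct H
    | H : _ \/ _ |- _ => destruct H
  end; lia.

Section Labels.

Variable n : nat.
Hypothesis n_gt0 : 0 < n.
Let P := (2 * n).-1.

(* At position i = t n + m with m < n, the end b = true is t + m and the end
   b = false is t - m modulo 2n - 1, replaced by infinity = 2n - 1 if m = 0. *)
Definition label (b : bool) (i : nat) : nat :=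
  let t := i %/ n in let m := i %% n in
  if b then (t + m) %% (2 * n).-1 else
  if m == 0 then (2 * n).-1 else (t + ((2 * n).-1 - m)) %% (2 * n).-1.

Arguments label : simpl never.

Lemma labelE b t m : m < n -> label b (t * n + m) =
  if b then (t + m) %% P else if m == 0 then P else (t + (P - m)) %% P.
Proof.
by move=> lt_mn; rewrite /label divnMDl // modnMDl divn_small // addn0 (modn_small lt_mn).
Qed.

Lemma label_lt b i : label b i < 2 * n.
Proof.
have P_gt0: 0 < P by rewrite /P; lia.
have lt_P a : a %% P < 2 * n by have := ltn_pmod a P_gt0; rewrite /P; lia.
by rewrite /label; case: b; last case: ifP => _; rewrite ?lt_P // /P; lia.
Qed.

Lemma label_period b i : label b (i + n * P) = label b i.
Proof.
rewrite (divn_eq i n) addnAC [n * P]mulnC -mulnDl !labelE ?ltn_pmod //.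
by rewrite !(addnAC _ P _) !modnDr.
Qed.

Lemma label_mod b i : label b (i %% (n * P)) = label b i.
Proof.
rewrite [in RHS](divn_eq i (n * P)); elim: (i %/ _) => [|c IHc] //.
by rewrite mulSn -addnA addnC label_period.
Qed.

Lemma label_reduce i : exists t m, [/\ t < P, m < n, m = i %[mod n]
  & forall b d, label b (i + d) = label b (t * n + (m + d))].
Proof.
have N_gt0 : 0 < n * P by rewrite muln_gt0 n_gt0 /P; lia.
exists (i %% (n * P) %/ n), (i %% (n * P) %% n); split.
- by rewrite ltn_divLR // [P * n]mulnC ltn_mod.
- by rewrite ltn_mod.
- by rewrite modn_mod modn_dvdm // dvdn_mulr.
by move=> b d; rewrite addnA -divn_eq -label_mod -(label_mod _ (_ + d)) modnDml.
Qed.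

(** Replaces the reductions modulo 2n - 1 by linear alternatives, fit for [lia]. Allowing t = P
    leaves room for the row after a reduced one. *)
Lemma label_spec b t m : t <= P -> m < n ->
  let v := label b (t * n + m) in
  if b then v < P /\ (v = t + m \/ v + P = t + m)
  else if m == 0 then v = P else v < P /\ (v + m = t \/ v + m = t + P).
Proof.
move=> le_tP lt_mn /=; rewrite labelE //; rewrite /P in le_tP *.
case: b.
  have lt2: t + m < 2 * (2 * n).-1 by lia.
  by have [[-> ?]|[-> ?]] := modn_lt_double lt2; lia.
case: eqP => // m_neq0.
have lt2: t + ((2 * n).-1 - m) < 2 * (2 * n).-1 by lia.
by have [[-> ?]|[-> ?]] := modn_lt_double lt2; lia.
Qed.

Lemma label_ends i : label true i != label false i.
Proof.
have [t [m [lt_tP lt_mn _ Di]]] := label_reduce i.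
rewrite -[i]addn0 !Di addn0.
have := label_spec true (ltnW lt_tP) lt_mn.
have := label_spec false (ltnW lt_tP) lt_mn; rewrite /= /P in lt_tP *.
by case: eqP; lia.
Qed.

Lemma label_next t m d : m < n -> d < n -> exists t' m',
  [/\ m' < n, forall b, label b (t * n + (m + d)) = label b (t' * n + m')
    & t' = t /\ m' = m + d \/ t' = t.+1 /\ m' + n = m + d].
Proof.
move=> lt_mn lt_dn; have [lt_n|le_n] := ltnP (m + d) n.
  by exists t, (m + d); split=> //; left.
exists t.+1, (m + d - n); split; [lia | | by right; lia].
by move=> b; congr label; rewrite mulSn; lia.
Qed.

(** The edges of one row partition the vertices. If [d] leads into row t + 1, then d < n - 1 and m'
    = m + d - n <= m - 2, which keeps t + m and t - m apart from t + 1 + m' and t + 1 - m' modulo 2n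
    - 1. *)
Lemma label_neq b b' i d : 0 < d -> d < n.-1 \/ d = n.-1 /\ n %| i ->
  label b i != label b' (i + d).
Proof.
move=> d_gt0 lt_dn1; have lt_dn: d < n by lia.
have [t [m [lt_tP lt_mn Dm Di]]] := label_reduce i.
have {}lt_dn1: d < n.-1 \/ d = n.-1 /\ m = 0.
  case: lt_dn1 => [|[? /eqP n_i]]; [by left | right; split=> //].
  by rewrite n_i modn_small in Dm.
rewrite -[in label b _](addn0 i) !Di addn0.
have [t' [m' [lt_m'n -> Dt']]] := label_next t lt_mn lt_dn.
have le_t'P: t' <= P by lia.
have := label_spec b (ltnW lt_tP) lt_mn.
have := label_spec b' le_t'P lt_m'n; rewrite /= /P in lt_tP le_t'P *.
case: (label b _ =P label b' _); last by [].
move: (label b _) (label b' _) => v v' <- {v' Di Dm}.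
by case: (m =P 0) => ?; case: (m' =P 0) => ?; case: b; case: b'; split_lia.
Qed.

(** From m > 0, going n - 1 positions on leads to m - 1 in the next row, and the only coincidence is
    t + m = (t + 1) + (m - 1). *)
Lemma label_eq_wrap b b' i : 1 < n -> ~~ (n %| i) ->
  (label b i == label b' (i + n.-1)) = b && b'.
Proof.
move=> n_gt1; rewrite /dvdn => n_i.
have [t [m [lt_tP lt_mn Dm Di]]] := label_reduce i.
have m_gt0: 0 < m by rewrite lt0n -(modn_small lt_mn) Dm.
have lt_dn: n.-1 < n by lia.
rewrite -[in label b _](addn0 i) !Di addn0.
have [t' [m' [lt_m'n -> Dt']]] := label_next t lt_mn lt_dn.
have le_t'P: t' <= P by lia.
have := label_spec b (ltnW lt_tP) lt_mn.
have := label_spec b' le_t'P lt_m'n; rewrite /= /P in lt_tP le_t'P *.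
move: (label b _) (label b' _) => v v' {Di Dm n_i}.
case: (m =P 0) => ?; first by lia.
by case: (m' =P 0) => ?; case: b; case: b' => /=; case: (v =P v'); split_lia.
Qed.

(** The ends of an edge without infinity sum to 2t modulo the odd number 2n - 1, which determines t;
    in an edge with infinity the other end is t. Then t and the ends determine m. *)
Lemma label_edge_inj i j : 
  (label true i = label true j /\ label false i = label false j) \/
  (label true i = label false j /\ label false i = label true j) ->
  i = j %[mod n * P].
Proof.
have N_gt0 : 0 < n * P by rewrite muln_gt0 n_gt0 /P; lia.
rewrite -!(label_mod _ i) -!(label_mod _ j).
move: (i %% _) (j %% _) (ltn_pmod i N_gt0) (ltn_pmod j N_gt0) => {}i {}j.
rewrite ![n * P]mulnC -!ltn_divLR // (divn_eq i n) (divn_eq j n).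
have := ltn_pmod i n_gt0; have := ltn_pmod j n_gt0.
move: (i %/ n) (i %% n) (j %/ n) (j %% n) => t m t' m' lt_m'n lt_mn.
rewrite !divnMDl // !divn_small // !addn0 => lt_tP lt_t'P.
have := label_spec true (ltnW lt_tP) lt_mn.
have := label_spec false (ltnW lt_tP) lt_mn.
have := label_spec true (ltnW lt_t'P) lt_m'n.
have := label_spec false (ltnW lt_t'P) lt_m'n.
rewrite /= -/P.
move: (label true (t * n + m)) (label false (t * n + m)) => x y.
move: (label true (t' * n + m')) (label false (t' * n + m')) => z w.
have DP : P.+1 = 2 * n by rewrite /P; lia.
move: P DP lt_tP lt_t'P => Q DP lt_tP lt_t'P {N_gt0} hw hz hy hx eq_xyzw.
suff Dt : t = t'.
  suff Dm : m = m' by rewrite Dt Dm.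
  move: hw hz hy hx; subst t'.
  case: eqP => ?; case: eqP => ?; split_lia.
move: hw hz hy hx.
case: eqP => ?; case: eqP => ?; [split_lia|split_lia|split_lia|].
move=> [? hw] [? hz] [? hy] [? hx].
have hxy : x + y = 2 * t \/ x + y = 2 * t + Q \/ x + y + Q = 2 * t.
  by clear -hx hy lt_tP lt_mn DP; split_lia.
have hzw : z + w = 2 * t' \/ z + w = 2 * t' + Q \/ z + w + Q = 2 * t'.
  by clear -hz hw lt_t'P lt_m'n DP; split_lia.
have : x + y = z + w by clear -eq_xyzw; split_lia.
clear - hxy hzw DP lt_tP lt_t'P.
by split_lia.
Qed.

End Labels.

Arguments label : simpl never.

(** * The cyclic sequence of edges and its relabelled arcs *)

Lemma card2_ends (V : finType) (e : {set V}) (x : V) : #|e| = 2 ->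
  nth x (enum e) 0 != nth x (enum e) 1 /\
  e = [set nth x (enum e) 0; nth x (enum e) 1].
Proof.
move=> e2; have ne: nth x (enum e) 0 != nth x (enum e) 1.
  by rewrite nth_uniq ?enum_uniq // -cardE e2.
split=> //; apply/esym/eqP; rewrite eqEcard cards2 ne e2 andbT.
by rewrite subUset !sub1set -!(mem_enum e) !mem_nth // -cardE e2.
Qed.

Lemma imset_perm_edge (V : finType) (u : {perm V}) (x y : V) :
  u @: [set x; y] = [set u x; u y].
Proof. by rewrite imsetU1 imset_set1. Qed.

Lemma imset_permM (V : finType) (u v : {perm V}) (e : {set V}) :
  (v * u)%g @: e = u @: (v @: e).
Proof. by rewrite -imset_comp; apply: eq_imset => x; rewrite permM. Qed.

Section Cycle.

Variable n : nat.
Hypothesis n_gt0 : 0 < n.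
Local Notation V := 'I_(2 * n).
Local Notation N := (n * (2 * n).-1).

Definition vertex (b : bool) (i : nat) : V := Ordinal (label_lt n_gt0 b i).

Definition cycle_edge (i : nat) : {set V} :=
  [set vertex true i; vertex false i].

Lemma vertex_ends i : vertex true i != vertex false i.
Proof. exact: label_ends. Qed.

Lemma vertex_eqb b c i : (vertex b i == vertex c i) = (b == c).
Proof.
have /negbTE ne := vertex_ends i.
by case: b c => [] []; rewrite ?eqxx // ?ne // eq_sym ne.
Qed.

Lemma mem_cycle_edge b i : vertex b i \in cycle_edge i.
Proof. by case: b; rewrite !inE eqxx ?orbT. Qed.

Lemma cycle_edgeP x i : reflect (exists b, x = vertex b i) (x \in cycle_edge i).
Proof.
apply: (iffP idP) => [|[b ->]]; last exact: mem_cycle_edge.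
by rewrite !inE => /orP[]/eqP->; [exists true | exists false].
Qed.

Lemma card_cycle_edge i : #|cycle_edge i| = 2.
Proof. by rewrite cards2 vertex_ends. Qed.

Lemma cycle_edge_period i : cycle_edge (i + N) = cycle_edge i.
Proof.
by congr [set _; _]; apply: val_inj; rewrite /= label_period.
Qed.

Lemma cycle_edge_inj i j : cycle_edge i = cycle_edge j -> i = j %[mod N].
Proof.
move=> eq_ij; apply: label_edge_inj => //.
have /cycle_edgeP[b Db]: vertex true i \in cycle_edge j.
  by rewrite -eq_ij mem_cycle_edge.
have /cycle_edgeP[c Dc]: vertex false i \in cycle_edge j.
  by rewrite -eq_ij mem_cycle_edge.
have := vertex_ends i; rewrite Db Dc.
by case: b c Db Dc => [] [] [Db] [Dc]; rewrite ?eqxx // => _; [left|right].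
Qed.

Lemma vertex_neq b c i j : i < j -> j - i < n.-1 \/ j - i = n.-1 /\ n %| i ->
  vertex b i != vertex c j.
Proof.
move=> lt_ij dP; have -> : j = i + (j - i) by lia.
by apply: label_neq => //; lia.
Qed.

Lemma vertex_eq b c i j : i < j + n.-1 -> j < i + n.-1 ->
  (vertex b i == vertex c j) = (i == j) && (b == c).
Proof.
move=> lt_i lt_j; case: (ltngtP i j) => [lt_ij|lt_ji|<-] /=.
- by apply/negbTE/vertex_neq => //; lia.
- by rewrite eq_sym; apply/negbTE/vertex_neq => //; lia.
exact: vertex_eqb.
Qed.

(** The first [n] positions form row t = 0, a perfect matching. *)
Lemma vertex_eq_factor b c i j : i < n -> j < n ->
  (vertex b i == vertex c j) = (i == j) && (b == c).
Proof.
move=> lt_i lt_j; case: (ltngtP i j) => [lt_ij|lt_ji|<-] /=.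
- apply/negbTE/vertex_neq => //.
  have [?|?] := ltnP (j - i) n.-1; [by left | right; split; first lia].
  by have -> : i = 0; [lia | rewrite dvdn0].
- rewrite eq_sym; apply/negbTE/vertex_neq => //.
  have [?|?] := ltnP (i - j) n.-1; [by left | right; split; first lia].
  by have -> : j = 0; [lia | rewrite dvdn0].
exact: vertex_eqb.
Qed.

(** The right-hand side is free of [x]: windows of [n] positions that do not begin with a row all
    have the same incidence pattern, so permutations carry one onto another. *)
Lemma vertex_eq_window x b c j k : 1 < n -> ~~ (n %| x) -> j < n -> k < n ->
  (vertex b (x + j) == vertex c (x + k)) =
  (j == k) && (b == c) ||
  [&& b, c & (j == 0) && (k == n.-1) || (k == 0) && (j == n.-1)].
Proof.
move=> n_gt1 n_x lt_j lt_k.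
have [/andP[/eqP-> /eqP->]|] := boolP ((j == 0) && (k == n.-1)).
  rewrite addn0; transitivity (b && c).
    by rewrite -(label_eq_wrap n_gt0 b c n_gt1 n_x).
  have /negbTE-> : 0 != n.-1 by lia.
  by case: b c => [] [].
have [/andP[/eqP-> /eqP->]|ne1 ne2] := boolP ((k == 0) && (j == n.-1)).
  rewrite addn0 (eq_sym (vertex b _)); transitivity (c && b).
    by rewrite -(label_eq_wrap n_gt0 c b n_gt1 n_x).
  have /negbTE-> : n.-1 != 0 by lia.
  by case: b c => [] [].
by rewrite vertex_eq ?eqn_add2l ?andbF ?orbF //; lia.
Qed.

Lemma val_vertex_first b k : k < n ->
  val (vertex b k) = if b then k else (2 * n).-1 - k.
Proof.
move=> lt_k; have := label_spec n_gt0 b (leq0n _) lt_k; rewrite /= mul0n add0n.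
by case: b => /=; [lia | case: (k =P 0) => ?; lia].
Qed.

(** Row t = 1. The case k = 1 is separate because there 2n - k would be infinity instead of 0. *)
Lemma val_vertex_second b k : k.+1 < n ->
  val (vertex b (n + k)) =
  if b then k.+1 else if k == 0 then (2 * n).-1 else if k == 1 then 0 else (2 * n) - k.
Proof.
move=> lt_k; have P_gt0 : 0 < (2 * n).-1 by lia.
have := label_spec n_gt0 b P_gt0 (ltnW lt_k); rewrite /= mul1n.
case: b => /=; first by lia.
by case: (k =P 0) => ?; case: (k =P 1) => ?; lia.
Qed.

Variable r : nat.
Hypothesis r_lt_n : r < n.

Definition cycle_arc (u : {perm V}) (i : nat) : {set {set V}} :=
  [set u @: cycle_edge (i + j) | j : 'I_r].

Lemma cycle_arcM (v u : {perm V}) i :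
  cycle_arc (v * u)%g i = [set u @: (e : {set V}) | e in cycle_arc v i].
Proof.
rewrite /cycle_arc -imset_comp; apply: eq_imset => j /=; exact: imset_permM.
Qed.

Lemma eq_cycle_arc (u v : {perm V}) i k :
  (forall j, j < r -> u @: cycle_edge (i + j) = v @: cycle_edge (k + j)) ->
  cycle_arc u i = cycle_arc v k.
Proof. by move=> eq_uv; apply: eq_imset => j; apply: eq_uv. Qed.

Lemma cycle_arc_period u i : cycle_arc u (i + N) = cycle_arc u i.
Proof.
by apply: eq_imset => j; rewrite addnAC cycle_edge_period.
Qed.

Lemma perm_cycle_edge_disjoint (u : {perm V}) i j : i < j + n.-1 -> j < i + n.-1 ->
  i != j -> [disjoint u @: cycle_edge i & u @: cycle_edge j].
Proof.
move=> lt_i lt_j ne_ij; rewrite disjoint_subset; apply/subsetP => _ /imsetP[x x_i ->].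
have /cycle_edgeP[b ->] := x_i; rewrite inE /= (mem_imset _ _ perm_inj).
by apply/cycle_edgeP => -[c /eqP]; rewrite vertex_eq // (negbTE ne_ij).
Qed.

Lemma perm_cycle_edge_eq (u : {perm V}) i j : i < j + n.-1 -> j < i + n.-1 ->
  u @: cycle_edge i = u @: cycle_edge j -> i = j.
Proof.
move=> lt_i lt_j eq_ij; apply/eqP/negPn/negP.
move=> /(perm_cycle_edge_disjoint u lt_i lt_j)/pred0P/(_ (u (vertex true i))).
by rewrite /= -eq_ij mem_imset ?mem_cycle_edge //; exact: perm_inj.
Qed.

Lemma cycle_arc_matching u i : cycle_arc u i \in matchings n r.
Proof.
rewrite inE; apply/and3P; split.
- apply/subsetP=> _ /imsetP[j _ ->]; rewrite inE.
  by rewrite card_imset ?card_cycle_edge //; exact: perm_inj.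
- apply/trivIsetP=> _ _ /imsetP[j _ ->] /imsetP[k _ ->] ne_jk.
  have lt_j := ltn_ord j; have lt_k := ltn_ord k.
  apply: perm_cycle_edge_disjoint; [lia | lia |].
  by apply: contraNneq ne_jk => /= ->.
rewrite card_imset ?card_ord // => j k /perm_cycle_edge_eq Djk.
have lt_j := ltn_ord j; have lt_k := ltn_ord k.
by apply/val_inj/(@addnI i)/Djk; lia.
Qed.

Lemma cycle_arc_meet u i j : cycle_arc u i :&: cycle_arc u j != set0 ->
  exists k l, [/\ k < r, l < r & i + k = j + l %[mod N]].
Proof.
case/set0Pn => _ /setIP[/imsetP[k _ ->] /imsetP[l _ eq_kl]].
exists k, l; split=> //; apply: cycle_edge_inj.
exact: imset_inj (@perm_inj _ u) _ _ eq_kl.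
Qed.

Lemma cycle_arc_transitive i (es : seq {set V}) : size es = r -> uniq es ->
  [set e in es] \in matchings n r ->
  exists u : {perm V}, forall j, j < r -> u @: cycle_edge (i + j) = nth set0 es j.
Proof.
move=> es_r es_uniq; rewrite inE => /and3P[/subsetP es2 /trivIsetP es_disj _].
pose x0 := vertex true 0.
pose g (jb : nat * bool) := vertex jb.2 (i + jb.1).
(* Read as an index, [~~ jb.2] sends the end [true] to the first element of the edge and [false] to
   the second. *)
pose h (jb : nat * bool) := nth x0 (enum (nth set0 es jb.1)) (~~ jb.2).
pose s := [seq (j, b) | j <- iota 0 r, b <- [:: true; false]].
have mem_s j b : ((j, b) \in s) = (j < r).
  apply/allpairsP/idP => [[[k c] /= [lt_k _ [-> _]]]|lt_j].
    by rewrite mem_iota in lt_k.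
  by exists (j, b); rewrite mem_iota; case: (b).
have es_nth j : j < r -> nth set0 es j \in [set e in es].
  by move=> lt_j; rewrite inE mem_nth ?es_r.
have ends j : j < r -> h (j, true) != h (j, false) /\
    nth set0 es j = [set h (j, true); h (j, false)].
  by move=> /es_nth/es2; rewrite inE => /eqP/(card2_ends x0).
have h_in j b : j < r -> h (j, b) \in nth set0 es j.
  by move=> /ends[_ ->]; case: b; rewrite !inE eqxx ?orbT.
have [|u uP] := @perm_extending _ _ g h s.
  move=> [j b] [k c]; rewrite !mem_s => lt_j lt_k.
  rewrite /g vertex_eq /=; [|lia|lia]; rewrite eqn_add2l.
  have [<-|ne_jk] := eqVneq j k => /=.
    have [/negbTE ne_h _] := ends j lt_j.
    by case: b c => [] []; rewrite ?eqxx ?ne_h // [RHS]eq_sym ne_h.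
  apply/esym/negbTE/eqP => eq_h.
  have /es_disj : nth set0 es j != nth set0 es k by rewrite nth_uniq ?es_r.
  move=> /(_ (es_nth _ lt_j) (es_nth _ lt_k))/pred0P/(_ (h (j, b))).
  by rewrite /= {2}eq_h !h_in.
exists u => j lt_j; have [_ ->] := ends j lt_j.
by rewrite imset_perm_edge -!(uP (j, _)) ?mem_s.
Qed.

End Cycle.

(** * Counting matchings *)

Lemma card_pairs (S T : finType) (D : {set S}) (E : S -> {set T}) (c : nat) :
  {in D, forall x, #|E x| = c} ->
  #|[set q : S * T | (q.1 \in D) && (q.2 \in E q.1)]| = #|D| * c.
Proof.
move=> cE; rewrite -sum1dep_card.
rewrite -(pair_big_dep (mem D) (fun x y => y \in E x) (fun _ _ => 1)) /=.
by rewrite -sum_nat_const; apply: eq_bigr => x Dx; rewrite sum1_card cE.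
Qed.

Lemma card_matching_cover n r (M : {set {set 'I_(2 * n)}}) : M \in matchings n r ->
  #|cover M| = 2 * r.
Proof.
rewrite inE => /and3P[/subsetP sM /eqP<- /eqP<-].
rewrite (eq_bigr (fun=> 2)) => [|e /sM]; last by rewrite inE => /eqP.
by rewrite sum_nat_const mulnC.
Qed.

(** Both sides count matchings of r + 1 edges with a marked edge; without it, r edges remain, and
    the marked edge lies among the 2n - 2r vertices they leave uncovered. *)
Lemma card_matchings_rec n r :
  #|matchings n r.+1| * r.+1 = #|matchings n r| * 'C(2 * n - 2 * r, 2).
Proof.
pose E (M : {set {set 'I_(2 * n)}}) :=
  [set e : {set 'I_(2 * n)} | e \subset ~: cover M & #|e| == 2].
rewrite -(@card_pairs _ _ _ id) => [|M]; last first.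
  by rewrite inE => /and3P[_ _ /eqP].
rewrite -(@card_pairs _ _ _ E) => [|M]; last first.
  move=> /card_matching_cover cM; rewrite cards_draws cardsCs setCK cM.
  by rewrite card_ord.
pose f (q : {set {set 'I_(2 * n)}} * {set 'I_(2 * n)}) := (q.1 :\ q.2, q.2).
set S1 := [set _ | _]; rewrite -(card_in_imset (f := f) (D := mem S1)); last first.
  move=> [M e] [M' e']; rewrite !inE /= => /andP[_ eM] /andP[_ eM'] [eqM eqe].
  by rewrite -(setD1K eM) eqM -eqe setD1K // eqe.
congr #|pred_of_set _|; apply/setP=> -[M e].
apply/imsetP/idP => [[[M' e'] + [-> ->]]|] /=.
  rewrite !inE /= => /andP[/and3P[sM tM /eqP cM] eM].
  have := subsetP sM _ eM; rewrite inE => ->; rewrite andbT -!andbA.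
  apply/and4P; split.
  - exact: subset_trans (subD1set _ _) sM.
  - exact: trivIsetS (subD1set _ _) tM.
  - by have := cardsD1 e' M'; rewrite eM cM => -[->].
  have/trivIsetP tP := tM.
  rewrite -disjoints_subset; apply/bigcup_disjointP => e1; rewrite !inE => /andP[ne eM'].
  by apply: tP; rewrite 1?eq_sym.
rewrite !inE /= => /andP[/and3P[sM tM /eqP cM] /andP[e_disj e2]].
have [||tU e_nM] := @trivIsetU1 _ e M _ tM.
- by apply/bigcup_disjointP; rewrite -/(cover M) disjoints_subset.
- by apply/negP => /(subsetP sM); rewrite inE cards0.
exists (e |: M, e); last by rewrite /f /= setU1K.
rewrite !inE /= eqxx orTb andbT cardsU1 e_nM cM eqxx andbT subUset sub1set inE e2 sM /=.
exact: tU.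
Qed.

Lemma card_matchings n r :
  #|matchings n r| * r`! = \prod_(0 <= i < r) 'C(2 * n - 2 * i, 2).
Proof.
elim: r => [|r IHr].
  rewrite big_nil muln1; apply/eqP/cards1P; exists set0.
  apply/setP=> M; rewrite !inE cards_eq0.
  apply/and3P/eqP => [[_ _ /eqP]|->] //; split; rewrite ?sub0set //.
  by apply/trivIsetP=> e f; rewrite inE.
by rewrite big_nat_recr //= -IHr factS mulnA card_matchings_rec mulnAC.
Qed.

(** * Averaging over the relabellings *)

Section Counting.

Variables n r : nat.
Hypotheses (n_gt0 : 0 < n) (r_lt_n : r < n).
Local Notation V := 'I_(2 * n).
Local Notation N := (n * (2 * n).-1).
Local Notation arc := (cycle_arc n_gt0 r).
Implicit Types (M : {set {set V}}) (B : {set {set {set V}}}).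

Lemma arc_onto_enum M i (es : seq {set V}) : M \in matchings n r ->
  uniq es -> es =i M ->
  exists2 u, arc u i = M &
    forall j, j < r -> u @: cycle_edge n_gt0 (i + j) = nth set0 es j.
Proof.
move=> X_M es_uniq esM; have Des : [set e in es] = M by apply/setP=> e; rewrite inE esM.
have sz_es : size es = r.
  by move: X_M; rewrite -Des inE cardsE (card_uniqP es_uniq) => /and3P[_ _ /eqP].
have [|u uP] := cycle_arc_transitive n_gt0 r_lt_n i sz_es es_uniq; first by rewrite Des.
exists u => //; apply/setP => e; rewrite -esM; apply/imsetP/idP => [[j _ ->]|].
  by rewrite uP // mem_nth ?sz_es.
move=> /(nthP set0)[j lt_j <-]; rewrite sz_es in lt_j.
by exists (Ordinal lt_j) => //=; rewrite uP.
Qed.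

Lemma arc_onto M i : M \in matchings n r -> exists u, arc u i = M.
Proof.
move=> X_M; have [||u <- _] := @arc_onto_enum M i (enum M) X_M; last by exists u.
- exact: enum_uniq.
- exact: mem_enum.
Qed.

Lemma card_arc_eq i M M' : M \in matchings n r -> M' \in matchings n r ->
  #|[set u | arc u i == M]| = #|[set u | arc u i == M']|.
Proof.
have le_card K K' : K \in matchings n r -> K' \in matchings n r ->
    #|[set u | arc u i == K]| <= #|[set u | arc u i == K']|.
  move=> /(@arc_onto _ i)[u uK] /(@arc_onto _ i)[u' uK'].
  rewrite -(card_imset _ (mulIg (u^-1 * u')%g)).
  apply/subset_leq_card/subsetP => _ /imsetP[v + ->]; rewrite !inE => /eqP vK.
  by rewrite -uK' cycle_arcM // vK -uK -cycle_arcM mulKVg.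
by move=> X_M X_M'; apply/eqP; rewrite eqn_leq !le_card.
Qed.

(** Every matching is the arc at [i] for the same number k of relabellings. Counting with [B] and
    with all matchings eliminates k. *)
Lemma sum_arc_in i B : B \subset matchings n r ->
  (\sum_u (arc u i \in B)) * #|matchings n r| = #|B| * #|{perm V}|.
Proof.
move=> sB; have [M0 X_M0] : exists M, M \in matchings n r.
  by exists (arc 1%g i); apply: cycle_arc_matching.
pose k := #|[set u | arc u i == M0]|.
have sumB (C : {set {set {set V}}}) : C \subset matchings n r ->
    \sum_u (arc u i \in C) = #|C| * k.
  move=> /subsetP sC.
  have -> : \sum_u (arc u i \in C) = \sum_(u | arc u i \in C) 1.
    by rewrite [RHS]big_mkcond; apply: eq_bigr => u _; case: (_ \in _).
  rewrite -sum_nat_const (partition_big (arc^~ i) (mem C)) //=.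
  apply: eq_bigr => M C_M; rewrite /k -(card_arc_eq i (sC _ C_M) X_M0) -sum1dep_card.
  by apply: eq_bigl => u; case: eqP => [->|]; rewrite ?C_M ?andbF.
have: \sum_u (arc u i \in matchings n r) = #|{perm V}|.
  by rewrite -sum1_card; apply: eq_bigr => u _; rewrite cycle_arc_matching.
by rewrite !sumB // => <-; rewrite -mulnA; congr (_ * _); rewrite mulnC.
Qed.

Lemma sum_arcs_in B : B \subset matchings n r ->
  (\sum_u \sum_(i < N) (arc u i \in B)) * #|matchings n r| =
  N * #|B| * #|{perm V}|.
Proof.
move=> sB; rewrite exchange_big big_distrl /= (eq_bigr (fun=> #|B| * #|{perm V}|)).
  by rewrite sum_nat_const card_ord mulnA.
by move=> i _; apply: sum_arc_in.
Qed.

Hypothesis r_gt0 : 0 < r.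

Lemma arcs3 : 3 * r <= N.
Proof. by nia. Qed.

Lemma arc_meetP B u : intersecting B -> forall i j, arc u i \in B -> arc u j \in B ->
  exists k l, [/\ k < r, l < r & i + k = j + l %[mod N]].
Proof. by move=> intB i j Bi Bj; apply: cycle_arc_meet (intB _ _ Bi Bj). Qed.

Lemma intersecting_arcs B : B \subset matchings n r -> intersecting B ->
  N * #|B| <= r * #|matchings n r| ?= iff [forall u, \sum_(i < N) (arc u i \in B) == r].
Proof.
move=> sB intB.
have G_gt0 : 0 < #|{perm V}| by apply/card_gt0P; exists 1%g.
have X_gt0 : 0 < #|matchings n r|.
  by apply/card_gt0P; exists (arc 1%g 0); apply: cycle_arc_matching.
have le_r : \sum_u \sum_(i < N) (arc u i \in B) <= \sum_(u : {perm V}) r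
    ?= iff [forall u, \sum_(i < N) (arc u i \in B) == r].
  apply: leqif_sum => u _; split=> //; apply: arcs_card arcs3 _ (arc_meetP intB) => i.
  by rewrite cycle_arc_period.
split.
  rewrite -(leq_pmul2r G_gt0) -sum_arcs_in // mulnAC leq_pmul2r //.
  by rewrite [r * _]mulnC -sum_nat_const le_r.
rewrite -(eqn_pmul2r G_gt0) -sum_arcs_in // mulnAC eqn_pmul2r //.
by rewrite [r * _]mulnC -sum_nat_const le_r.
Qed.

(** Each star is intersecting, hence obeys the bound. Double counting the pairs of a matching and
    one of its edges shows that the bounds summed over all [N] edges are attained, so each of them
    is. *)
Lemma card_matchings_through e : e \in edges n ->
  N * #|matchings_through r e| = r * #|matchings n r|.
Proof.
have star_le (f : {set V}) : N * #|matchings_through r f| <= r * #|matchings n r|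
    ?= iff (N * #|matchings_through r f| == r * #|matchings n r|).
  have sB : matchings_through r f \subset matchings n r.
    by apply/subsetP=> M; rewrite inE => /andP[].
  have iB : intersecting (matchings_through r f).
    move=> M M'; rewrite !inE => /andP[_ fM] /andP[_ fM'].
    by apply/set0Pn; exists f; rewrite inE fM.
  by split=> //; have [] := intersecting_arcs sB iB.
have [_ sum_eq] := leqif_sum (fun (f : {set V}) (_ : f \in edges n) => star_le f).
suff Dsum : \sum_(f in edges n) N * #|matchings_through r f| =
            \sum_(f in edges n) r * #|matchings n r|.
  by move: sum_eq; rewrite Dsum eqxx => /esym/forall_inP eq_e /eq_e/eqP.
rewrite -big_distrr sum_nat_const card_draws card_ord /=; congr (_ * _).
  by rewrite bin2 -mulnA [X in _ = X./2]mul2n doubleK.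
pose X := matchings n r.
transitivity (\sum_(f in edges n) \sum_(M in X | f \in M) 1).
  by apply: eq_bigr => f _; rewrite sum1dep_card; apply: eq_card => M; rewrite !inE.
rewrite (exchange_big_dep (mem X)) => [|f M _ /andP[]] //=.
rewrite [r * _]mulnC -sum_nat_const; apply: eq_bigr => M X_M.
have /and3P[/subsetP sM _ /eqP cM] : [&& M \subset edges n, trivIset M & #|M| == r].
  by move: X_M; rewrite inE.
rewrite -[RHS]cM -sum1_card; apply: eq_bigl => f /=; rewrite X_M /=.
by rewrite andb_idl // => /sM.
Qed.

End Counting.

(** * The case of equality *)

Lemma tperm_imset (V : finType) (x y : V) (e : {set V}) :
  (x \in e) = (y \in e) -> tperm x y @: e = e.
Proof.
move=> e_xy; apply/eqP; rewrite eqEcard card_imset ?leqnn ?andbT; last exact: perm_inj.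
apply/subsetP => _ /imsetP[z e_z ->].
by case: tpermP => // Dz; rewrite Dz in e_z; rewrite (e_xy, =^~ e_xy).
Qed.

Section Extremal.

Variables n r : nat.
Hypotheses (n_gt0 : 0 < n) (r_lt_n : r < n) (r_gt0 : 0 < r).
Local Notation V := 'I_(2 * n).
Local Notation N := (n * (2 * n).-1).
Local Notation arc := (cycle_arc n_gt0 r).
Local Notation F := (cycle_edge n_gt0).
Local Notation vertex := (vertex n_gt0).

Variable A : {set {set {set V}}}.
Hypotheses (subA : A \subset matchings n r) (intA : intersecting A).
Hypothesis maxA : N * #|A| = r * #|matchings n r|.

Lemma card_arcs_extremal u : \sum_(i < N) (arc u i \in A) = r.
Proof.
have [_] := intersecting_arcs n_gt0 r_lt_n r_gt0 subA intA.
by rewrite maxA eqxx => /esym/forallP/(_ u)/eqP.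
Qed.

(* The arcs in A are exactly those through position n - 1. *)
Definition centered (u : {perm V}) := (arc u n.-1 \in A) && (arc u n \notin A).

(** The arcs in [A] form one run of [r] consecutive starts, so its last start is n - 1 exactly when
    its first is n - r. Both descriptions serve, as they involve edges on opposite sides of the
    centre. *)
Lemma centeredE u : centered u = (arc u (n.-1 - r) \notin A) && (arc u (n - r) \in A).
Proof.
have arcA i : (arc u (i + N) \in A) = (arc u i \in A) by rewrite cycle_arc_period.
have meetA := arc_meetP (n_gt0 := n_gt0) (r := r) (u := u) intA.
have := arcs_card_ends (p := fun i => arc u i \in A) (arcs3 n_gt0 r_lt_n r_gt0) arcA meetA
  (n.-1 - r) r_gt0 (card_arcs_extremal u).
rewrite /centered; have -> : n.-1 - r + r = n.-1 by lia.
have -> : n.-1 - r + r.+1 = n by lia.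
by have -> : (n.-1 - r).+1 = n - r by lia.
Qed.

Lemma centered_exists : exists u, centered u.
Proof.
have /card_gt0P[M A_M] : 0 < #|A|.
  have: 0 < r * #|matchings n r|.
    rewrite muln_gt0 r_gt0; apply/card_gt0P; exists (arc 1%g 0).
    exact: cycle_arc_matching.
  by rewrite -maxA muln_gt0 => /andP[].
(* With a member at n - r, the run ends at some x from n - r to n - 1, which is not the beginning of
   a row. *)
have [u Du] := arc_onto n_gt0 r_lt_n (n - r) (subsetP subA _ A_M).
have arcA i : (arc u (i + N) \in A) = (arc u i \in A) by rewrite cycle_arc_period.
have meetA := arc_meetP (n_gt0 := n_gt0) (r := r) (u := u) intA.
have := arcs_card_last (p := fun i => arc u i \in A) (arcs3 n_gt0 r_lt_n r_gt0) arcA meetA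
  (s := n - r) r_gt0 (card_arcs_extremal u).
rewrite Du => /(_ A_M)[x [x_bounds A_x A'x]].
(* The edges at positions x, ..., x + r and n - 1, ..., n - 1 + r meet in the same
   pattern, so some v maps the latter to the former. *)
have n_gt1 : 1 < n by lia.
have ndvd y : 0 < y < n -> ~~ (n %| y).
  by case/andP=> y_gt0 lt_y; rewrite /dvdn modn_small // -lt0n.
pose g i (jb : nat * bool) := vertex jb.2 (i + jb.1).
pose s := [seq (j, b) | j <- iota 0 n, b <- [:: true; false]].
have mem_s j b : ((j, b) \in s) = (j < n).
  apply/allpairsP/idP => [[[k c] /= [lt_k _ [-> _]]]|lt_j].
    by rewrite mem_iota in lt_k.
  by exists (j, b); rewrite mem_iota; case: (b).
have [|v vP] := @perm_extending _ _ (g n.-1) (g x) s.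
  move=> [j b] [k c]; rewrite !mem_s => lt_j lt_k.
  by rewrite /g /= !vertex_eq_window //; apply: ndvd; lia.
have vF j : j < n -> v @: F (n.-1 + j) = F (x + j).
  by move=> lt_j; rewrite imset_perm_edge !(vP (j, _)) ?mem_s.
exists (v * u)%g; rewrite /centered.
have -> : arc (v * u)%g n.-1 = arc u x.
  by apply: eq_cycle_arc => j lt_j; rewrite imset_permM vF //; lia.
have -> : arc (v * u)%g n = arc u x.+1.
  apply: eq_cycle_arc => j lt_j; rewrite imset_permM.
  by rewrite addSnnS -vF; [congr (_ @: (_ @: F _)); lia | lia].
by rewrite A_x.
Qed.

Definition linked (x y : V) := forall u, centered u -> centered (tperm x y * u)%g.

Lemma linked_sym x y : linked x y -> linked y x.
Proof. by move=> xy u; rewrite tpermC; apply: xy. Qed.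

Lemma linked_trans y x z : linked x y -> linked y z -> linked x z.
Proof.
move=> xy yz u Cu.
have [<-|ne_xz] := eqVneq x z; first by rewrite tperm1 mul1g.
have [Dx|ne_xy] := eqVneq x y; first by rewrite Dx; apply: yz.
(* The transposition (x z) is the conjugate of (x y) by (y z). *)
have -> : tperm x z = (tperm y z * (tperm x y * tperm y z))%g.
  have := tpermJ x y (tperm y z).
  by rewrite tpermL tpermD 1?eq_sym // => <-; rewrite conjgE tpermV.
by rewrite -!mulgA; apply/yz/xy/yz.
Qed.

Lemma arc_tperm x y u i :
    (forall j, j < r -> (x \in F (i + j)) = (y \in F (i + j))) ->
  arc (tperm x y * u)%g i = arc u i.
Proof.
move=> F_xy; apply: eq_cycle_arc => j lt_j.
by rewrite imset_permM tperm_imset ?F_xy.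
Qed.

Lemma mem_cycle_edge_ends i j :
  (forall b c, (vertex b i == vertex c j) = (i == j) && (b == c)) ->
  (vertex true i \in F j) = (vertex false i \in F j).
Proof. by move=> ij; rewrite !inE !ij; case: (i == j). Qed.

Lemma linked_first k : k < n -> linked (vertex true k) (vertex false k).
Proof.
move=> lt_k u; rewrite !centeredE !arc_tperm // => j lt_j.
  by apply: mem_cycle_edge_ends => b c; apply: vertex_eq_factor; lia.
by apply: mem_cycle_edge_ends => b c; apply: vertex_eq_factor; lia.
Qed.

Lemma linked_second k : k.+2 < n -> linked (vertex true (n + k)) (vertex false (n + k)).
Proof.
move=> lt_k u; rewrite /centered !arc_tperm // => j lt_j.
  by apply: mem_cycle_edge_ends => b c; apply: vertex_eq; lia.
by apply: mem_cycle_edge_ends => b c; apply: vertex_eq; lia.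
Qed.

(** Row 1 links k + 2 = 1 + (k + 1) to 1 - (k + 1) = -k, and row 0 links -k to k, so the induction
    descends by two. Infinity is joined to 0 in row 0 and to 1 in row 1. *)
Lemma linked_infinity_true k : k < n.-1 -> linked (vertex true k) (vertex false 0).
Proof.
elim/ltn_ind: k => -[|[|k]] IHk lt_k; first by apply: linked_first.
  have -> : vertex true 1 = vertex true (n + 0).
    by apply: val_inj; rewrite val_vertex_first ?val_vertex_second //; lia.
  have -> : vertex false 0 = vertex false (n + 0).
    by apply: val_inj; rewrite val_vertex_first ?val_vertex_second //=; lia.
  by apply: linked_second; lia.
have lt_k2 : k.+2 < n by lia.
have -> : vertex true k.+2 = vertex true (n + k.+1).
  by apply: val_inj; rewrite val_vertex_first ?val_vertex_second.
apply: linked_trans (linked_second _) _; first by lia.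
(* For k = 0 the end [false] of position k is infinity, so 0 is taken as its end [true]. *)
have -> : vertex false (n + k.+1) = vertex (k == 0) k.
  apply: val_inj; rewrite val_vertex_second ?val_vertex_first //=; last by lia.
  by case: (k =P 0) => [-> //|]; case: eqP; lia.
apply: linked_trans (IHk k _ _); [|lia|lia].
case: eqP => _; first by move=> u; rewrite tperm1 mul1g.
by apply/linked_sym/linked_first; lia.
Qed.

Lemma vertex_first (x : V) : exists b k, k < n /\ x = vertex b k.
Proof.
have lt_x := ltn_ord x; have [lt_xn|le_nx] := ltnP x n.
  by exists true, x; split=> //; apply: val_inj; rewrite val_vertex_first.
exists false, ((2 * n).-1 - x); split; first by lia.
by apply: val_inj; rewrite val_vertex_first /=; lia.
Qed.

Lemma linked_center x y : (x \in F n.-1) = (y \in F n.-1) -> linked x y.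
Proof.
have link1 b c k : k < n -> linked (vertex b k) (vertex c k).
  move=> /linked_first link_k; have link1 b' : linked (vertex b' k) (vertex true k).
    by case: b'; [move=> u; rewrite tperm1 mul1g | apply: linked_sym].
  exact: linked_trans (link1 b) (linked_sym (link1 c)).
have [b [k [lt_k ->]]] := vertex_first x; have [c [l [lt_l ->]]] := vertex_first y.
have memF b' k' : k' < n -> (vertex b' k' \in F n.-1) = (k' == n.-1).
  by move=> lt_k'; rewrite !inE !vertex_eq_factor ?ltn_predL // -andb_orr;
    case: b'; rewrite andbT.
rewrite !memF // => eq_kl.
have link2 b' k' : k' < n -> k' != n.-1 -> linked (vertex b' k') (vertex false 0).
  move=> lt_k' ne_k'; apply: linked_trans (link1 b' true k' lt_k') _.
  by apply: linked_infinity_true; lia.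
have [Dk|ne_k] := eqVneq k n.-1.
  move: eq_kl; rewrite Dk eqxx => /esym/eqP->.
  by apply: link1; rewrite ltn_predL.
by apply: linked_trans (link2 _ _ _ _) (linked_sym (link2 _ _ _ _)); rewrite -?eq_kl.
Qed.

(** Induction on the number of points where [u] and [w] differ: precomposing [u] with the
    transposition of x and u^-1 (w x) creates agreement at x and spoils no other. Both points or
    neither lie in the central edge, since [u] and [w] give it the same image. *)
Lemma centered_same_edge (u w : {perm V}) :
  centered u -> u @: F n.-1 = w @: F n.-1 -> centered w.
Proof.
have [m] := ubnP #|[set x | u x != w x]|; elim: m u => // m IHm u le_m Cu eqF.
have [x ne_x | eq_uw] := pickP (fun x => u x != w x); last first.
  suff <- : u = w by [].
  by apply/permP => x; apply/eqP/negPn; rewrite eq_uw.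
pose y := (u^-1)%g (w x); have uy : u y = w x by rewrite /y permKV.
have eq_xy : (x \in F n.-1) = (y \in F n.-1).
  by rewrite -(mem_imset (F n.-1) x (@perm_inj _ w)) -eqF -uy mem_imset //;
    apply: perm_inj.
apply: (IHm (tperm x y * u)%g); last by rewrite imset_permM tperm_imset.
  rewrite -ltnS; apply: leq_trans le_m; rewrite ltnS; apply: proper_card.
  apply/properP; split; last first.
    by exists x; rewrite !inE // permM tpermL uy eqxx.
  apply/subsetP => z; rewrite !inE permM; case: tpermP => [->|->|] //.
  move=> _; rewrite uy (inj_eq perm_inj).
  by apply: contraNneq ne_x => Dx; rewrite -uy -Dx.
exact: linked_center.
Qed.

Lemma extremal_star : exists2 e, e \in edges n & A = matchings_through r e.
Proof.
have [u Cu] := centered_exists; pose e := u @: F n.-1.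
have edge_e : e \in edges n.
  by rewrite inE card_imset ?card_cycle_edge //; apply: perm_inj.
exists e => //; apply/esym/eqP; rewrite eqEcard; apply/andP; split.
  apply/subsetP => M; rewrite inE => /andP[X_M eM].
  (* Listing [e] first makes [w] send the central edge to [e], as [u] does. *)
  have [||w <- wP] := arc_onto_enum n_gt0 r_lt_n n.-1 (es := e :: enum (M :\ e)) X_M.
  - by rewrite /= enum_uniq mem_enum !inE eqxx.
  - by move=> f; rewrite inE mem_enum !inE; case: eqP => [->|].
  have := wP 0 r_gt0; rewrite addn0 => /= wF.
  by have /andP[] : centered w by apply: centered_same_edge Cu _; rewrite wF.
rewrite -(leq_pmul2l (_ : 0 < N)) ?muln_gt0 ?n_gt0 ?maxA ?card_matchings_through //; lia.
Qed.

End Extremal.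

(** * From the counts to [phi] *)

Lemma card_matchings_prod n r : 0 < r ->
  r * #|matchings n r| * (r - 1)`! =
  n * (2 * n).-1 * \prod_(1 <= i < r) 'C(2 * n - 2 * i, 2).
Proof.
case: r => // r _; rewrite big_add1.
have := card_matchings n r.+1; rewrite big_nat_recl //=.
rewrite muln0 subn0 bin2 -mulnA [X in X./2]mul2n doubleK => <-.
by rewrite subn1 factS mulnCA mulnA.
Qed.

Import GRing.Theory Num.Theory.

(** By [card_matchings_prod], [phi n r] is r |M^r_n| / N, so comparisons with it are comparisons of
    natural numbers. *)
Lemma phi_natr n r m : 0 < n -> 0 < r ->
  ((m%:R <= phi n r)%R = (n * (2 * n).-1 * m <= r * #|matchings n r|)) *
  ((m%:R == phi n r)%R = (n * (2 * n).-1 * m == r * #|matchings n r|)).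
Proof.
move=> n_gt0 r_gt0; have fact0 := fact_gt0 (r - 1).
have N_gt0 : 0 < n * (2 * n).-1 by rewrite muln_gt0 n_gt0; lia.
have fact0R : (0 < (r - 1)`!%:R :> rat)%R by rewrite ltr0n.
rewrite /phi ler_pdivlMr // -natrM ler_nat.
rewrite -(inj_eq (mulIf (lt0r_neq0 fact0R))) divfK ?lt0r_neq0 // -natrM eqr_nat.
rewrite -(leq_pmul2l N_gt0) -(eqn_pmul2l N_gt0) -card_matchings_prod // mulnA.
by rewrite leq_pmul2r // eqn_pmul2r.
Qed.

Theorem theorem2 (n r : nat) (n_gt0 : 0 < n) (r_gt0 : 0 < r) (r_lt_n : r < n)
    (A : {set {set {set 'I_(2 * n)}}}) :
  A \subset matchings n r -> intersecting A ->
  (#|A|%:R <= phi n r)%R /\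
  ((#|A|%:R)%R = phi n r <->
   exists2 e : {set 'I_(2 * n)}, e \in edges n & A = matchings_through r e).
Proof.
move=> subA intA; have [phi_ge _] := phi_natr #|A| n_gt0 r_gt0; split.
  by rewrite phi_ge (intersecting_arcs n_gt0 r_lt_n r_gt0 subA intA).
split=> [/eqP|[e edge_e ->]].
  by rewrite phi_natr // => /eqP /(extremal_star n_gt0 r_lt_n r_gt0 subA intA).
by apply/eqP; rewrite phi_natr // card_matchings_through.
Qed.
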